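(* Let $p$ be a fixed prime and let $\epsilon>0$ be a real number. Then, as functions of $r\in\mathbb{N}$, \[ v(p,p^r-1)=\begin{cases}\mathcal{O}\left(r^{(2+\epsilon)\ln(p)}\right) & \text{if } p>2,\\ \mathcal{O}\left(r^{2+\epsilon}\right) & \text{if } p=2.\end{cases} \]
   Context: Let $F$ be an algebraically closed field of characteristic $p>0$. For $k\in\mathbb{N}$, $v(p,k)$ denotes the smallest natural number $s$ such that every polynomial in $F[t]$ can be written as a sum of at most $s$ $k$-th powers of polynomials in $F[t]$ (with no restriction on the degrees of the polynomials being raised to the $k$-th power); if no such $s$ exists, $v(p,k)=\infty$. *)

(* Defs.v *)
From HB Require Import structures.
From Stdlib Require Import Reals.
From mathcomp Require Import all_boot all_order all_algebra.
Set Implicit Arguments. Unset Strict Implicit. Unset Printing Implicit Defensive.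
Import GRing.Theory.

Local Open Scope ring_scope.

Definition waring_sum (F : closedFieldType) (k s : nat) (f : {poly F}) : Prop :=
  exists fs : seq {poly F}, (size fs <= s)%N /\ f = \sum_(g <- fs) g ^+ k.

(* [waring_ok F k s]: every polynomial in F[t] is a sum of at most s k-th powers,
   i.e. s is admissible in the definition of v(p,k); v(p,k) is the least such s
   (or infinity if none). *)
Definition waring_ok (F : closedFieldType) (k s : nat) : Prop :=
  forall f : {poly F}, waring_sum k s f.

(* [v_le F k b]: v(p,k) <= b (for F of characteristic p), i.e. v(p,k) is finite
   and its least admissible value is at most the real number b. Since the set of
   admissible s is upward closed, this is equivalent to the minimum being <= b. *)
Definition v_le (F : closedFieldType) (k : nat) (b : R) : Prop :=
  exists s : nat, waring_ok F k s /\ Rle (INR s) b.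

(* Main.v *)
(** Put q = p^r and S(x) = \sum_(c in F_p) (x + c)^(q-1).  In characteristic p,
    (x^p - x) S(x) = - (x^q - x) = - \sum_(i < r) (x^p - x)^(p^i), so if
    x^p - x = z y with z constant, then z S(x) = - \sum_(i < r) z^(p^i) y^(p^i-1)
    is sparse in y.  Choose r constants z_j for which the matrix z_j^(p^i) is
    invertible; a suitable linear combination of the z_j S(x_j) is then y^(p-1),
    at the price of r p powers.  This needs one y for which all the equations
    x_j^p - x_j = z_j y are solvable in F[t]: an additive polynomial
    Y = t + (terms in t^(p^i), 1 <= i <= r) does it.  Replacing t by t + b turns
    Y into Y + Y(b), and p such translates of Y^(p-1) combine to Y; replacing t by
    b t, r+1 dilates of Y combine to t.  Hence v(p, p^r - 1) <= (r+1) p^2 r,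
    and r^2 is within the stated bound since ln p >= 1 for p >= 3. *)
Require Import Defs.
From Stdlib Require Import Reals.
From mathcomp Require Import all_boot all_order all_algebra.
From mathcomp Require Import ring.
From Stdlib Require Import Lra.
Set Implicit Arguments. Unset Strict Implicit. Unset Printing Implicit Defensive.
Import GRing.Theory.

(** * Closure of sums of [k]-th powers under linear combination and substitution *)

Section WaringSums.
Local Open Scope ring_scope.
Variables (F : closedFieldType) (k : nat).
Hypothesis k_gt0 : (0 < k)%N.

(** A scalar of an algebraically closed field is itself a [k]-th power, so it is absorbed into the
    bases. *)
Lemma waring_sumZ s (a : F) (f : {poly F}) :
  waring_sum k s f -> waring_sum k s (a *: f).
Proof.
have [b bk] : exists b : F, b ^+ k = a.
  have /closed_rootP [b] : size ('X^k - a%:P) != 1%N.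
    by rewrite size_XnsubC // eqSS -lt0n.
  by rewrite rootE !hornerE subr_eq0 => /eqP; exists b.
move=> [fs [fs_s ->]]; exists [seq b *: g | g <- fs].
rewrite size_map; split=> //; rewrite big_map scaler_sumr.
by apply: eq_bigr => g _; rewrite exprZn bk.
Qed.

Lemma waring_sum_comb n s (w : 'I_n -> F) (f : 'I_n -> {poly F}) :
  (forall i, waring_sum k s (f i)) ->
  waring_sum k (n * s) (\sum_(i < n) w i *: f i).
Proof.
move=> f_s; elim: n w f f_s => [|n IHn] w f f_s.
  by exists [::]; rewrite big_ord0 big_nil.
have [//|fs [fs_n sum_fs]] := IHn (fun i => w (lift ord0 i)) (fun i => f (lift ord0 i)).
have [gs [gs_s sum_gs]] := waring_sumZ (w ord0) (f_s ord0).
exists (gs ++ fs); rewrite size_cat mulSn leq_add //.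
by rewrite big_cat big_ord_recl sum_fs sum_gs.
Qed.

Lemma waring_sum_comp s (f g : {poly F}) :
  waring_sum k s f -> waring_sum k s (f \Po g).
Proof.
move=> [fs [fs_s ->]]; exists [seq h \Po g | h <- fs].
rewrite size_map; split=> //; rewrite big_map raddf_sum.
by apply: eq_bigr => h _; apply: (rmorphXn (comp_poly g)).
Qed.

(** Substituting [f] for the variable in a representation of ['X] represents [f]. *)
Lemma waring_ok_X s : waring_sum k s ('X : {poly F}) -> waring_ok F k s.
Proof. by move=> X_s f; rewrite -[f](comp_polyX f); apply: waring_sum_comp. Qed.

End WaringSums.

(** * Isolating one exponent by generalized Vandermonde matrices *)

Section GeneralizedVandermonde.
Local Open Scope ring_scope.
Variable F : closedFieldType.

(* The nodes are the powers of one element g, so that the matrix is a genuine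
   Vandermonde matrix in the g ^+ e i. *)
Lemma generalized_vandermonde_unit n (e : 'I_n -> nat) : injective e ->
  exists b : 'I_n -> F, \matrix_(j, i) b j ^+ e i \in unitmx.
Proof.
move=> e_inj.
(* A non-root [g] of [P] makes the [g ^+ e i] pairwise distinct. *)
pose P : {poly F} := \prod_(i < n) \prod_(j < n | (i < j)%N) ('X^(e j) - 'X^(e i)).
have /closed_nonrootP [g Pg] : P != 0.
  apply/prodf_neq0 => i _; apply/prodf_neq0 => j ij; rewrite subr_eq0.
  apply: contraTneq ij => /(congr1 (fun f : {poly F} => size f)).
  by rewrite !size_polyXn => -[/e_inj->]; rewrite ltnn.
exists (fun j => g ^+ j).
have -> : \matrix_(j, i) (g ^+ nat_of_ord j) ^+ e i =
    Vandermonde n (\row_i g ^+ e i).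
  by apply/matrixP => j i; rewrite !mxE -!exprM mulnC.
rewrite unitmxE unitfE det_Vandermonde.
apply: contra Pg => /eqP det0; rewrite rootE horner_prod -{}det0.
apply/eqP/eq_bigr => i _; rewrite horner_prod.
by apply: eq_bigr => j _; rewrite !mxE !hornerE.
Qed.

Lemma exp_nodes_dual n (e : 'I_n -> nat) (b : 'I_n -> F) (d : 'I_n -> F) :
  \matrix_(j, i) b j ^+ e i \in unitmx ->
  exists w : 'I_n -> F, forall i, \sum_j w j * b j ^+ e i = d i.
Proof.
set M := \matrix_(j, i) _ => Mu; pose w := (\row_i d i) *m invmx M.
exists (w 0) => i; have := congr1 (fun A : 'rV_n => A 0 i) (mulmxKV Mu (\row_i d i)).
by rewrite !mxE => <-; apply: eq_bigr => j _; rewrite [M _ _]mxE.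
Qed.

Lemma exp_nodes_interp n (e : 'I_n -> nat) (b : 'I_n -> F) (d : 'I_n -> F) :
  \matrix_(j, i) b j ^+ e i \in unitmx ->
  exists v : 'I_n -> F, forall j, \sum_i v i * b j ^+ e i = d j.
Proof.
set M := \matrix_(j, i) _ => Mu; pose v := invmx M *m (\col_j d j).
exists (v^~ 0) => j; have := congr1 (fun A : 'cV_n => A j 0) (mulKVmx Mu (\col_j d j)).
by rewrite !mxE => <-; apply: eq_bigr => i _; rewrite [M _ _]mxE mulrC.
Qed.

Lemma exp_filter n (e : 'I_n -> nat) (i0 : 'I_n) : injective e ->
  exists b w : 'I_n -> F, forall i, \sum_j w j * b j ^+ e i = (i == i0)%:R.
Proof.
move=> /generalized_vandermonde_unit [b bu]; exists b.
exact: exp_nodes_dual (fun i => (i == i0)%:R) bu.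
Qed.

Lemma filter_sum n (V : lmodType F) (w : 'I_n -> F) (c : 'I_n -> 'I_n -> F)
    (i0 : 'I_n) (f : 'I_n -> V) :
  (forall i, \sum_j w j * c j i = (i == i0)%:R) ->
  \sum_j w j *: (\sum_i c j i *: f i) = f i0.
Proof.
move=> wE; under eq_bigr do rewrite scaler_sumr.
rewrite exchange_big (bigD1 i0) //= [X in _ + X]big1 => [|i i_neq].
  by under eq_bigr do rewrite scalerA; rewrite -scaler_suml wE eqxx scale1r addr0.
by under eq_bigr do rewrite scalerA; rewrite -scaler_suml wE (negPf i_neq) scale0r.
Qed.

End GeneralizedVandermonde.

(** * Additivity of Frobenius powers *)

Section Frobenius.
Local Open Scope ring_scope.
Variables (p : nat) (A : comNzRingType).
Hypothesis pcharA : p \in [pchar A].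

Lemma exprD_ppow n (x y : A) : (x + y) ^+ (p ^ n) = x ^+ (p ^ n) + y ^+ (p ^ n).
Proof. by rewrite exprDn_pchar // pnatX pnatE ?pcharA ?(pcharf_prime pcharA). Qed.

Lemma exprB_ppow n (x y : A) : (x - y) ^+ (p ^ n) = x ^+ (p ^ n) - y ^+ (p ^ n).
Proof. by rewrite -[X in _ = X ^+ _ - _](subrK y x) [in RHS]exprD_ppow addrK. Qed.

Lemma ppow_gt0 n : (0 < p ^ n)%N.
Proof. by rewrite expn_gt0 prime_gt0 ?(pcharf_prime pcharA). Qed.

Lemma expr_sum_ppow n (I : finType) (f : I -> A) :
  (\sum_i f i) ^+ (p ^ n) = \sum_i f i ^+ (p ^ n).
Proof.
apply: (big_morph (fun x => x ^+ (p ^ n))) => [x y|]; first exact: exprD_ppow.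
by rewrite expr0n eqn0Ngt ppow_gt0.
Qed.

Lemma natr_ppow n m : (m%:R : A) ^+ (p ^ n) = m%:R.
Proof.
elim: n => [|n IHn]; first by rewrite expr1.
by rewrite expnSr exprM IHn -(pFrobenius_autE pcharA) pFrobenius_aut_nat.
Qed.

Lemma artin_schreier_telescope r (x : A) :
  \sum_(i < r) (x ^+ p - x) ^+ (p ^ i) = x ^+ (p ^ r) - x.
Proof.
elim: r => [|r IHr]; first by rewrite big_ord0 expn0 expr1 subrr.
by rewrite big_ord_recr /= IHr exprB_ppow -exprM -expnS addrC addrA subrK.
Qed.

End Frobenius.

(** * Shifted power sums and Artin-Schreier equations *)

Section ShiftedPowers.
Local Open Scope ring_scope.
Variables (p : nat) (F : fieldType).
Hypothesis pcharF : p \in [pchar F].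
Let p_prime : prime p := pcharf_prime pcharF.
Let p_gt0 : (0 < p)%N := prime_gt0 p_prime.

Let pcharP : p \in [pchar {poly F}].
Proof. by rewrite pchar_poly. Qed.

(** By Fermat's little theorem each of the [p - 1] non-zero terms is 1. *)
Lemma sum_natr_pred_pow : \sum_(c < p) (c%:R : F) ^+ p.-1 = -1.
Proof.
have p1_gt0 : (0 < p.-1)%N by rewrite -ltnS prednK ?prime_gt1.
rewrite -(big_mkord xpredT (fun c => (c%:R : F) ^+ p.-1)).
rewrite big_ltn // expr0n eqn0Ngt p1_gt0 add0r.
rewrite (eq_big_nat _ _ (F2 := fun=> 1)) => [|c /andP[c_gt0 c_p]].
  by rewrite sumr_const_nat subn1 -subn1 natrB // (pcharf0 pcharF) sub0r.
have c_neq0 : (c%:R : F) != 0.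
  by rewrite -(dvdn_pcharf pcharF) gtnNdvd.
apply: (mulfI c_neq0); rewrite -exprS prednK // mulr1.
by rewrite -{1}(expn1 p) natr_ppow.
Qed.

Lemma sum_shift_pred_pow (x : {poly F}) : \sum_(c < p) (x + c%:R) ^+ p.-1 = -1.
Proof.
(* [T] has degree below [p]; it vanishes at 0 and is invariant under translation by 1, so it has the
   [p] elements of the prime field as roots. *)
pose T : {poly F} := \sum_(c < p) ('X + c%:R%:P) ^+ p.-1 + 1.
have T_per (y : F) : T.[y + 1] = T.[y].
  rewrite !hornerD !horner_sum !hornerC; congr (_ + _).
  pose f m := (y + m%:R) ^+ p.-1.
  transitivity (\sum_(0 <= c < p) f c.+1).
    rewrite big_mkord; apply: eq_bigr => c _.
    by rewrite !hornerE /f -addrA -natr1 [1 + _]addrC.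
  transitivity (\sum_(0 <= c < p) f c); last first.
    by rewrite big_mkord; apply: eq_bigr => c _; rewrite !hornerE.
  apply/eqP; rewrite -subr_eq0 -sumrB telescope_sumr // /f.
  by rewrite (pcharf0 pcharF) subrr.
have T_root m : root T m%:R.
  elim: m => [|m IHm]; last by rewrite rootE -natr1 T_per.
  rewrite rootE hornerD horner_sum hornerC.
  under eq_bigr do rewrite !hornerE.
  by rewrite sum_natr_pred_pow addNr.
have T0 : T = 0.
  apply/eqP/negP => /negP T_neq0.
  pose rs := [seq (m%:R : F) | m <- iota 0 p].
  have : (size rs < size T)%N.
    apply: max_poly_roots => //; first by apply/allP => _ /mapP[m _ ->].
    rewrite map_inj_in_uniq ?iota_uniq // => m1 m2; rewrite !mem_iota !add0n /=.
    wlog le12 : m1 m2 / (m1 <= m2)%N => [IH l1 l2 e|_ l2 /eqP].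
      by case/orP: (leq_total m1 m2) => h; [|apply/esym]; apply: IH.
    rewrite eq_sym -subr_eq0 -natrB // -(dvdn_pcharf pcharF) => dv.
    apply/eqP; rewrite eqn_leq le12 -subn_eq0 -leqn0 leqNgt /=.
    apply/negP => h; move: (dvdn_leq h dv); rewrite leqNgt.
    by rewrite (leq_ltn_trans (leq_subr _ _) l2).
  apply/negP; rewrite size_map size_iota -leqNgt.
  rewrite (leq_trans (size_polyD _ _)) // size_poly1 geq_max p_gt0 andbT.
  apply: (leq_trans (size_sum _ _ _)); apply/bigmax_leqP => c _.
  by rewrite (leq_trans (size_poly_exp_leq _ _)) // size_XaddC mul1n prednK.
have := congr1 (fun f => f \Po x) T0.
rewrite comp_poly0 /T rmorphD /= rmorph1 raddf_sum /= => /eqP.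
rewrite addr_eq0 => /eqP <-; apply: eq_bigr => c _.
by rewrite [RHS](rmorphXn (comp_poly x)) /= comp_polyD comp_polyX comp_polyC polyC_natr.
Qed.

Lemma artin_schreier_shift_sum r (x : {poly F}) :
  (x ^+ p - x) * \sum_(c < p) (x + c%:R) ^+ (p ^ r).-1 =
  - \sum_(i < r) (x ^+ p - x) ^+ (p ^ i).
Proof.
have exp1D c : (x + c%:R) ^+ p = x ^+ p + c%:R.
  by have := exprD_ppow pcharP 1 x c%:R; rewrite (natr_ppow pcharP) expn1.
rewrite (artin_schreier_telescope pcharP) mulr_sumr.
(* Since [x ^+ p - x = (x + c) ^+ p - (x + c)], each term on the left is [((x + c) ^+ p.-1 - 1) * (x
   ^+ (p ^ r) + c)]. Terms free of [c] then sum to 0, being repeated [p] times. *)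
transitivity (\sum_(c < p) ((x ^+ (p ^ r) - x) * (x + c%:R) ^+ p.-1
                - (x ^+ (p ^ r) - x) + (x ^+ p - x))).
  apply: eq_bigr => c _.
  have Eq : (x + c%:R) * (x + c%:R) ^+ (p ^ r).-1 = x ^+ (p ^ r) + c%:R.
    by rewrite -exprS prednK ?(ppow_gt0 pcharP) // (exprD_ppow pcharP) (natr_ppow pcharP).
  have Ep : (x + c%:R) * (x + c%:R) ^+ p.-1 = x ^+ p + c%:R.
    by rewrite -exprS prednK // exp1D.
  move: Eq Ep; set u := _ ^+ (p ^ r).-1; set v := _ ^+ p.-1 => Eq Ep.
  have -> : x ^+ p - x = (x + c%:R) * v - (x + c%:R) by rewrite Ep; ring.
  rewrite mulrBl [_ * v * u]mulrAC Eq; ring.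
rewrite big_split sumrB -mulr_sumr sum_shift_pred_pow !sumr_const card_ord.
by rewrite !(mulrn_pchar pcharP) /= addr0 subr0 mulrN1.
Qed.

(* If zeta is a root of \sum_i theta_i Z^(p^i), then zeta^(p^r) times this
   polynomial has the form x^p - x; reversing the order of the coefficients and
   twisting them by Frobenius makes the obstruction to this vanish at zeta. *)
Definition dual_additive_poly r (theta : nat -> F) : {poly F} :=
  \sum_(i < r.+1) theta (r - i)%N ^+ (p ^ i) *: 'X^(p ^ i).

Lemma artin_schreier_solvable r (theta : nat -> F) (zeta : F) :
  \sum_(i < r.+1) theta i * zeta ^+ (p ^ i) = 0 ->
  exists x, x ^+ p - x = zeta ^+ (p ^ r) *: dual_additive_poly r theta.
Proof.
move=> th0.
(* [gam m] collects the top [m] terms of the relation [th0], so it vanishes at [m = 0] and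
   [m = r.+1]: the shift of index caused by the [p]-th power leaves no boundary term, and
   consecutive [gam] differ by a single term. *)
pose gam m := \sum_(l < m) theta (r - l)%N * zeta ^+ (p ^ (r - l)).
have gam0 : gam 0 = 0 by rewrite /gam big_ord0.
have gamr : gam r.+1 = 0.
  rewrite /gam (reindex_inj rev_ord_inj) /= -[RHS]th0.
  by apply: eq_bigr => l _; rewrite subSS subKn // -ltnS.
pose h m : {poly F} := gam m ^+ (p ^ m) *: 'X^(p ^ m).
have h0 : h 0 = 0 by rewrite /h gam0 expn0 expr1 scale0r.
have hr : h r.+1 = 0.
  by rewrite /h gamr expr0n eqn0Ngt (ppow_gt0 pcharF) scale0r.
exists (- \sum_(i < r.+1) gam i.+1 ^+ (p ^ i) *: 'X^(p ^ i)).
have -> : (- \sum_(i < r.+1) gam i.+1 ^+ (p ^ i) *: 'X^(p ^ i)) ^+ p =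
   - \sum_(i < r.+1) h i :> {poly F}.
  have := exprB_ppow pcharP 1 0 (\sum_(i < r.+1) gam i.+1 ^+ (p ^ i) *: 'X^(p ^ i)).
  rewrite expn1 expr0n eqn0Ngt p_gt0 !sub0r => ->; congr (- _).
  have := expr_sum_ppow pcharP 1 (fun i : 'I_r.+1 => gam i.+1 ^+ (p ^ i) *: 'X^(p ^ i)).
  rewrite expn1 => ->.
  transitivity (\sum_(i < r.+1) h i.+1).
    by apply: eq_bigr => i _; rewrite exprZn -!exprM -expnSr.
  transitivity (h 0 + \sum_(i < r.+1) h i.+1); first by rewrite h0 add0r.
  by rewrite -(big_ord_recl r.+1 h) big_ord_recr /= hr addr0.
rewrite opprK addrC -sumrB /dual_additive_poly scaler_sumr.
apply: eq_bigr => i _; rewrite /h -scalerBl -(exprB_ppow pcharF).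
rewrite [gam i.+1]/gam big_ord_recr /= -/(gam i) addrAC subrr add0r.
by rewrite exprMn -exprM -expnD subnK -1?ltnS // scalerA mulrC.
Qed.

End ShiftedPowers.

(** * From [Y ^+ p.-1] to [Y], and from [Y] to ['X] *)

Section ClosedField.
Local Open Scope ring_scope.
Variables (p : nat) (F : closedFieldType).
Hypothesis pcharF : p \in [pchar F].
Let p_prime : prime p := pcharf_prime pcharF.
Let p_gt0 : (0 < p)%N := prime_gt0 p_prime.

Let pcharP : p \in [pchar {poly F}].
Proof. by rewrite pchar_poly. Qed.

Lemma expn_ord_inj n : injective (fun i : 'I_n => (p ^ i)%N).
Proof. by move=> i j /(expnI (prime_gt1 p_prime))/val_inj. Qed.

Lemma ppow_pred_gt0 r : (0 < r)%N -> (0 < (p ^ r).-1)%N.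
Proof.
move=> r_gt0; rewrite -ltnS prednK ?(ppow_gt0 pcharF) //.
by rewrite -(expn0 p) ltn_exp2l ?prime_gt1.
Qed.

Lemma waring_dual_additive_pred_pow r : (1 < r)%N ->
  exists2 theta : nat -> F, theta r = 1 &
    waring_sum (p ^ r).-1 (r * p) (dual_additive_poly p r theta ^+ p.-1).
Proof.
move=> r_gt1.
have [zeta zeta_unit] := generalized_vandermonde_unit F (@expn_ord_inj r).
have [th thE] := exp_nodes_interp (fun j => - zeta j ^+ (p ^ r)) zeta_unit.
(* Index 1 is selected because [Y ^+ (p ^ 1)] is [Y] times the desired [Y ^+ p.-1]. *)
have [w wE] := exp_nodes_dual (fun i => (i == Ordinal r_gt1)%:R) zeta_unit.
(* The default 1 supplies the top coefficient [theta r]; by [thE] every [zeta j] is then a root of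
   the additive polynomial with coefficients [theta]. *)
pose theta m := oapp th 1 (insub m).
have theta_r : theta r = 1 by rewrite /theta insubN //= ltnn.
exists theta => //; set Y := dual_additive_poly p r theta.
have /fin_all_exists [x xE] j :
    exists x, x ^+ p - x = zeta j ^+ (p ^ r) *: Y.
  apply: (artin_schreier_solvable pcharF).
  rewrite big_ord_recr /= theta_r mul1r -[X in _ + X]opprK -thE.
  by apply/eqP; rewrite subr_eq0; apply/eqP/eq_bigr => i _; rewrite /theta valK.
have [Y0|Y_neq0] := eqVneq Y 0.
  have p1_gt0 : (0 < p.-1)%N by rewrite -ltnS prednK ?prime_gt1.
  by exists [::]; rewrite Y0 big_nil expr0n eqn0Ngt p1_gt0.
pose S j := \sum_(c < p) (x j + c%:R) ^+ (p ^ r).-1.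
have SE j : zeta j ^+ (p ^ r) *: (Y * S j) =
    - \sum_(i < r) (zeta j ^+ (p ^ i)) ^+ (p ^ r) *: Y ^+ (p ^ i).
  rewrite scalerAl -xE (artin_schreier_shift_sum pcharF); congr (- _).
  by apply: eq_bigr => i _; rewrite xE exprZn -!exprM mulnC.
(* The weights are [p ^ r]-th powers because [SE] carries the Frobenius twist of the matrix to which
   [wE] applies. *)
have -> : Y ^+ p.-1 = \sum_(j < r) (- (w j ^+ (p ^ r) * zeta j ^+ (p ^ r))) *: S j.
  apply: (mulfI Y_neq0); rewrite -exprS prednK // mulr_sumr.
  under eq_bigr do rewrite -scalerAr scaleNr -scalerA SE scalerN opprK.
  rewrite (filter_sum (i0 := Ordinal r_gt1)) ?expn1 // => i.
  under eq_bigr do rewrite -exprMn.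
  rewrite -(expr_sum_ppow pcharF) wE; case: eqP => _; first by rewrite expr1n.
  by rewrite expr0n eqn0Ngt (ppow_gt0 pcharF).
have k_gt0 := ppow_pred_gt0 (ltnW r_gt1).
apply: waring_sum_comb => // j; rewrite -[X in waring_sum _ X]muln1 /S.
under eq_bigr do rewrite -[_ ^+ _]scale1r.
apply: waring_sum_comb => // c; exists [:: x j + c%:R].
by rewrite big_seq1.
Qed.

Lemma dual_additive_polyD r (theta : nat -> F) (b : F) :
  dual_additive_poly p r theta \Po ('X + b%:P) =
  dual_additive_poly p r theta + (dual_additive_poly p r theta).[b]%:P.
Proof.
rewrite raddf_sum horner_sum rmorph_sum -big_split; apply: eq_bigr => i _ /=.
rewrite comp_polyZ comp_Xn_poly (exprD_ppow pcharP) scalerDr.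
by rewrite hornerZ hornerXn polyCM polyC_exp mul_polyC.
Qed.

Lemma dual_additive_poly_coef1 r (theta : nat -> F) :
  (dual_additive_poly p r theta)`_1 = theta r.
Proof.
rewrite coef_sum big_ord_recl /= big1 => [|i _].
  by rewrite coefZ coefXn subn0 expr1 mulr1 addr0.
rewrite coefZ coefXn eq_sym -[X in _ == X](expn0 p) eqn_exp2l ?prime_gt1 //.
by rewrite mulr0.
Qed.

Lemma waring_dual_additive k s r (theta : nat -> F) : (0 < k)%N ->
  theta r = 1 -> waring_sum k s (dual_additive_poly p r theta ^+ p.-1) ->
  waring_sum k (p * s) (dual_additive_poly p r theta).
Proof.
move=> k_gt0 theta_r; have := dual_additive_polyD r theta.
have := dual_additive_poly_coef1 r theta; rewrite theta_r.
set Y := dual_additive_poly p r theta => Y1 YD Ys.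
(* [p.-1 - i] is the exponent of [b j] in the binomial expansion of [(b j + Y) ^+ p.-1]; selecting
   [i = 1] leaves [(p - 1) Y = - Y]. *)
have p1_gt0 : (1 < p.-1.+1)%N by rewrite prednK ?prime_gt1.
have e_inj : injective (fun i : 'I_p.-1.+1 => p.-1 - i)%N.
  by move=> i j /(congr1 (subn p.-1)); rewrite !subKn -1?ltnS // => /val_inj.
have [b [w wE]] := exp_filter F (Ordinal p1_gt0) e_inj.
have /fin_all_exists [beta betaE] j : exists beta, Y.[beta] = b j.
  (* [Y] is non-constant, its linear coefficient being 1, so it attains every value. *)
  have /closed_rootP [beta] : size (Y - (b j)%:P) != 1%N.
    apply/negP => /size_poly1P [c _ /(congr1 (fun f : {poly F} => f`_1))].
    by rewrite coefB !coefC subr0 Y1 => /eqP; rewrite oner_eq0.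
  by rewrite rootE !hornerE subr_eq0 => /eqP; exists beta.
have -> : Y = (-1) *: \sum_j w j *: (Y ^+ p.-1 \Po ('X + (beta j)%:P)).
  under eq_bigr => j _.
    rewrite [_ \Po _](rmorphXn (comp_poly _)) /= YD betaE addrC exprDn.
    under eq_bigr do rewrite -rmorphXn mul_polyC scalerMnr.
    over.
  rewrite (filter_sum (i0 := Ordinal p1_gt0)) // bin1 expr1 scaleN1r.
  by rewrite -subn1 mulrnBr ?(mulrn_pchar pcharP) ?sub0r ?opprK.
rewrite -[in (p * s)%N](prednK p_gt0).
by apply/waring_sumZ/waring_sum_comb => // j; apply: waring_sum_comp.
Qed.

(** Dilation by [b j] multiplies the term in ['X^(p ^ i)] by [b j ^+ (p ^ i)]; filtering on [i = 0]
    leaves [theta r *: 'X]. *)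
Lemma waring_ok_of_dual_additive k s r (theta : nat -> F) : (0 < k)%N ->
  theta r = 1 -> waring_sum k s (dual_additive_poly p r theta) ->
  waring_ok F k (r.+1 * s).
Proof.
move=> k_gt0 theta_r Ys; apply: waring_ok_X.
have [b [w wE]] := exp_filter F ord0 (@expn_ord_inj r.+1).
have -> : 'X = \sum_j w j *: (dual_additive_poly p r theta \Po (b j *: 'X)).
  under eq_bigr => j _.
    rewrite raddf_sum /=.
    under eq_bigr do rewrite comp_polyZ comp_Xn_poly exprZn scalerA mulrC -scalerA.
    over.
  by rewrite (filter_sum _ wE) subn0 theta_r expr1 scale1r.
by apply: waring_sum_comb => // j; apply: waring_sum_comp.
Qed.

Lemma waring_ok_ppow_pred r : (1 < r)%N ->
  waring_ok F (p ^ r - 1) (r.+1 * (p * (r * p))).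
Proof.
move=> r_gt1; rewrite subn1.
have k_gt0 := ppow_pred_gt0 (ltnW r_gt1).
have [theta theta_r Ys] := waring_dual_additive_pred_pow r_gt1.
exact/(waring_ok_of_dual_additive k_gt0 theta_r)/waring_dual_additive.
Qed.

End ClosedField.

(** * Comparison with the real bound *)

Section QuadraticBound.
Local Open Scope R_scope.

Lemma INR_quadratic_le_Rpower (p r : nat) (eps : R) :
  (1 < p)%N -> (1 < r)%N -> 0 < eps ->
  INR (r.+1 * (p * (r * p)))%N <=
  2 * INR p * INR p *
  Rpower (INR r) (if (2 < p)%N then (2 + eps) * ln (INR p) else 2 + eps).
Proof.
move=> p_gt1 r_gt1 eps_gt0.
have INR_leq m n : (m <= n)%N -> INR m <= INR n by move/leP; exact: le_INR.
have p_ge2 : 2 <= INR p by exact: (INR_leq 2%N).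
have r_ge2 : 2 <= INR r by exact: (INR_leq 2%N).
set e := (if _ then _ else _).
have e_ge2 : 2 <= e.
  rewrite /e; case: ifP => [p_gt2|_]; last lra.
  (* For [p >= 3] this follows from [exp 1 <= 3]. *)
  have lnp_ge1 : 1 <= ln (INR p).
    have p_ge3 : 3 <= INR p by have := INR_leq _ _ p_gt2; rewrite /=; lra.
    apply: Rnot_lt_le => /exp_increasing; rewrite exp_ln; last lra.
    by have := exp_le_3; lra.
  nra.
have r2_le : INR r * INR r <= Rpower (INR r) e.
  have -> : INR r * INR r = Rpower (INR r) 2.
    by rewrite (Rpower_pow 2) /=; lra.
  by apply: Rle_Rpower; lra.
rewrite !mult_INR S_INR.
have p2_ge0 : 0 <= INR p * INR p by nra.
apply: (Rle_trans _ (2 * INR p * INR p * (INR r * INR r))); last first.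
  by apply: Rmult_le_compat_l => //; nra.
(* This product is exactly the gap between the two sides. *)
have : 0 <= (INR p * INR p) * (INR r * (INR r - 1)).
  by apply: Rmult_le_pos => //; nra.
nra.
Qed.

Lemma prime_const_gt0 (p : nat) : (0 < p)%N -> 0 < 2 * INR p * INR p.
Proof. by move=> /ltP/lt_0_INR p_gt0; nra. Qed.

End QuadraticBound.

Theorem theorem4 (p : nat) (eps : R) (F : closedFieldType) :
  prime p -> Rlt 0 eps -> p \in [pchar F]%R ->
  exists (C : R) (N : nat), Rlt 0 C /\
    forall r : nat, (N <= r)%N ->
      v_le F (p ^ r - 1)%N
        (Rmult C (Rpower (INR r)
               (if (2 < p)%N then Rmult (Rplus 2 eps) (ln (INR p)) else Rplus 2 eps))).
Proof.
(* [C] is fixed by the next line as [2 p^2]; [N = 2] ensures that index 1 lies below [r]. *)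
move=> p_prime eps_gt0 pcharF; eexists; exists 2%N.
split; first exact: (prime_const_gt0 (prime_gt0 p_prime)).
move=> r r_gt1; exists (r.+1 * (p * (r * p)))%N.
split; first exact: waring_ok_ppow_pred.
exact: INR_quadratic_le_Rpower (prime_gt1 p_prime) r_gt1 eps_gt0.
Qed.
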